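(* Let $n\ge 2$ and let $g_1,\dots,g_r\in\mathbb R[X_1,\dots,X_n]$ satisfy $\|g_i\|\le\tfrac12$ for all $i$ and $1-\|\mathbf X\|_2^2\in\mathcal Q_{\ell_0}(\mathbf g)$ for some $\ell_0\in\mathbb N$. Let $\mathfrak c\ge1,\textit{Ł}\ge1$ satisfy $D(x)^{\textit{Ł}}\le \mathfrak c\,G(x)$ on $[-1,1]^n$, and let $\gamma(n,\mathbf g)\ge 1$ be a constant depending only on $n,\mathbf g$ such that every $f\in\mathbb R[\mathbf X]$ with $f^*>0$ lies in $\mathcal Q_\ell(\mathbf g)$ whenever $\ell\ge\gamma(n,\mathbf g)\,d(f)^{3.5n\textit{Ł}}\epsilon(f)^{-2.5n\textit{Ł}}$. Let $0<\epsilon\le\tfrac12$, $t\in\mathbb N$, $t\ge1$, and $\ell\in\mathbb N$ with $$\ell\ge \gamma(n,\mathbf g)\,6^{2.5n\textit{Ł}}\,t^{6n\textit{Ł}}\binom{n+t}{t}^{2.5n\textit{Ł}}\epsilon^{-2.5n\textit{Ł}}\quad\text{and}\quad \ell\ge 2t+\ell_0 .$$ Then $d_H\big(\mathcal M^{(1)}(S)^{[2t]},\ \mathcal L^{(1)}_\ell(\mathbf g)^{[2t]}\big)\le\epsilon$.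
   Context: $\mathbb R[\mathbf X]=\mathbb R[X_1,\dots,X_n]$, $\Sigma^2$ sums of squares, $S=\{x: g_i(x)\ge0\ \forall i\}$ (nonempty), $\mathcal Q_\ell(\mathbf g)=\{s_0+\sum_i s_ig_i: s_j\in\Sigma^2,\deg s_0\le\ell,\deg(s_ig_i)\le\ell\}$, $\|h\|=\max_{[-1,1]^n}|h|$, $\|\mathbf X\|_2^2=\sum X_i^2$, $d(f)=\deg f$, $f^*=\min_S f$, $\epsilon(f)=f^*/\|f\|$, $G(x)=|\min\{g_1(x),\dots,g_r(x),0\}|$, $D(x)=\operatorname{dist}(x,S)$. A linear functional $L$ on $\mathbb R[\mathbf X]_k$ (polynomials of degree $\le k$) is identified with its vector $(L(\mathbf X^\alpha))_{|\alpha|\le k}$, and distances are Euclidean distances between these vectors; $L^{[2t]}$ is the restriction to $\mathbb R[\mathbf X]_{2t}$. $\mathcal M^{(1)}(S)^{[2t]}=\{(\int \mathbf x^\alpha d\mu)_{|\alpha|\le 2t}: \mu$ a Borel probability measure supported on $S\}$. $\mathcal L^{(1)}_\ell(\mathbf g)=\{L\in(\mathbb R[\mathbf X]_\ell)^*: L(q)\ge0\ \forall q\in\mathcal Q_\ell(\mathbf g),\ L(1)=1\}$ and $\mathcal L^{(1)}_\ell(\mathbf g)^{[2t]}$ is the set of restrictions to $\mathbb R[\mathbf X]_{2t}$. $d_H(A,B)=\max\{\sup_{a\in A}\operatorname{dist}(a,B),\sup_{b\in B}\operatorname{dist}(b,A)\}$ is the Hausdorff distance. *)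

(* Defs.v *)
From mathcomp Require Import all_boot all_order all_algebra.
Import Order.TTheory GRing.Theory Num.Theory.
From mathcomp Require Import mpoly.
From mathcomp Require Import boolp classical_sets reals ereal topology normedtype.
From mathcomp Require Import measure lebesgue_measure lebesgue_integral probability exp.

Set Implicit Arguments.
Unset Strict Implicit.
Unset Printing Implicit Defensive.

Local Open Scope classical_set_scope.
Local Open Scope ring_scope.

Section Defs.
Variables (R : realType) (n : nat).

(* points of R^n are n-tuples (this carries the product = Borel sigma-algebra) *)
Definition peval (p : {mpoly R[n]}) (x : n.-tuple R) : R := p.@[tnth x].

(* total degree d(p) (deg 0 := 0) ; "deg p <= l" as msize p <= l+1 *)
Definition pdeg (p : {mpoly R[n]}) : nat := (msize p).-1.
Definition deg_le (p : {mpoly R[n]}) (l : nat) : bool := (msize p <= l.+1)%N.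

Definition is_sos (p : {mpoly R[n]}) : Prop :=
  exists s : seq {mpoly R[n]}, p = \sum_(q <- s) q ^+ 2.

Definition qmodule (r : nat) (g : 'I_r -> {mpoly R[n]}) (l : nat) : set {mpoly R[n]} :=
  [set p | exists (s0 : {mpoly R[n]}) (s : 'I_r -> {mpoly R[n]}),
     [/\ is_sos s0, forall i, is_sos (s i), deg_le s0 l,
         forall i, deg_le (s i * g i) l &
         p = s0 + \sum_(i < r) s i * g i]].

Definition semialg (r : nat) (g : 'I_r -> {mpoly R[n]}) : set (n.-tuple R) :=
  [set x | forall i, 0 <= peval (g i) x].

Definition cube : set (n.-tuple R) := [set x | forall i, -1 <= tnth x i <= 1].

Definition supnorm (h : {mpoly R[n]}) : R := sup [set `|peval h x| | x in cube].

Definition sqnorm : {mpoly R[n]} := \sum_(i < n) 'X_i ^+ 2.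

Definition pmin (r : nat) (g : 'I_r -> {mpoly R[n]}) (f : {mpoly R[n]}) : R :=
  inf [set peval f x | x in semialg g].

Definition eps_f (r : nat) (g : 'I_r -> {mpoly R[n]}) (f : {mpoly R[n]}) : R :=
  pmin g f / supnorm f.

Definition Gviol (r : nat) (g : 'I_r -> {mpoly R[n]}) (x : n.-tuple R) : R :=
  `| \big[Num.min/0]_(i < r) peval (g i) x |.

Definition edist (x y : n.-tuple R) : R :=
  Num.sqrt (\sum_(i < n) (tnth x i - tnth y i) ^+ 2).

Definition Dist (r : nat) (g : 'I_r -> {mpoly R[n]}) (x : n.-tuple R) : R :=
  inf [set edist x y | y in semialg g].

Definition monom (a : 'X_{1..n}) (x : n.-tuple R) : R :=
  \prod_(i < n) tnth x i ^+ a i.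

(* truncated moment / functional vectors, indexed by monomials of degree <= k *)
Definition vec (k : nat) := 'X_{1..n < k.+1} -> R.

Definition vdist (k : nat) (a b : vec k) : R :=
  Num.sqrt (\sum_(m : 'X_{1..n < k.+1}) (a m - b m) ^+ 2).

Definition setdist (k : nat) (a : vec k) (B : set (vec k)) : \bar R :=
  ereal_inf [set (vdist a b)%:E | b in B].

Definition hausdorff (k : nat) (A B : set (vec k)) : \bar R :=
  maxe (ereal_sup [set setdist a B | a in A]) (ereal_sup [set setdist b A | b in B]).

Definition moment_set (r : nat) (g : 'I_r -> {mpoly R[n]}) (t : nat) : set (vec (2 * t)) :=
  [set v | exists P : probability (n.-tuple R) R,
     (exists A, [/\ measurable A, A `<=` semialg g & P A = 1%E]) /\
     v = fun m => fine (\int[P]_x (monom (bmnm m) x)%:E)].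

(* a linear functional on R[X] identified with its values on monomials *)
Definition lapply (L : 'X_{1..n} -> R) (p : {mpoly R[n]}) : R :=
  \sum_(m <- msupp p) p@_m * L m.

Definition functional_set (r : nat) (g : 'I_r -> {mpoly R[n]}) (l t : nat) : set (vec (2 * t)) :=
  [set v | exists L : 'X_{1..n} -> R,
     [/\ forall q, qmodule g l q -> 0 <= lapply L q, lapply L 1 = 1 &
         v = fun m => L (bmnm m)]].

End Defs.

Arguments moment_set {R n r} g t.
Arguments functional_set {R n r} g l t.

(* Main.v *)
Require Import Defs.
From HB Require Import structures.
From mathcomp Require Import all_boot all_order all_algebra.
Import Order.TTheory GRing.Theory Num.Theory.
From mathcomp Require Import mpoly ssrcomplements.
From mathcomp Require Import boolp classical_sets reals ereal topology normedtype.
From mathcomp Require Import measure lebesgue_measure lebesgue_integral probability exp.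
From mathcomp Require Import measurable_realfun.
From mathcomp Require Import ring lra zify.
Set Implicit Arguments.
Unset Strict Implicit.
Unset Printing Implicit Defensive.
Local Open Scope classical_set_scope.
Local Open Scope ring_scope.

(** Let [L] be a functional of the right-hand set and suppose that its truncation [v] lies
    at distance more than [eps] from the convex set of moment vectors. A unit vector [a]
    separates [v] from that set, so for [c] slightly larger than [L a] the polynomial
    [f = \sum_m a_m X^m - c] is at least [eps] on [S], whereas [L f < 0]. Multiplying
    [1 - |X|^2] by squares of monomials gives [|L X^m| <= 1] up to degree [2 t]; as a
    monomial of degree at most [2 t] is a product of two of degree at most [t], there are
    at most ['C(n + t, t) ^ 2] of them, and Cauchy-Schwarz bounds [f] by [2 'C(n + t, t)]
    on the cube. The degree bound of the Positivstellensatz then puts [f] in the truncated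
    quadratic module, so [0 <= L f], a contradiction. Conversely every moment vector is
    itself (the truncation of) such a functional. *)

(** * Splitting and counting monomials *)

Lemma mnm_neq0_decomp n (m : 'X_{1..n}) :
  m != 0%MM -> exists i m', m = (U_(i) + m')%MM.
Proof.
move=> m0; have /existsP[i mi] : [exists i, m i != 0%N].
  apply: contraT; rewrite negb_exists => /forallP mi.
  by move: m0; rewrite (_ : m = 0%MM) ?eqxx//; apply/mnmP => i; rewrite mnm0E;
     apply/eqP; rewrite -[_ == _]negbK.
exists i, (m - U_(i))%MM; rewrite addmC submK//; apply/mnm_lepP => j.
by rewrite mnm1E; case: eqP => // <-; rewrite lt0n.
Qed.

(** Induction on [s]: each step moves one variable of [m] into [a], until [s] variables have moved
    or [m] is exhausted. *)
Lemma mnm_split n (m : 'X_{1..n}) (s t : nat) : (mdeg m <= s + t)%N ->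
  exists a b, [/\ m = (a + b)%MM, (mdeg a <= s)%N & (mdeg b <= t)%N].
Proof.
elim: s m => [|s IHs] m; first by exists 0%MM, m; rewrite add0m mdeg0.
have [->|/mnm_neq0_decomp[i [m' ->]]] := eqVneq m 0%MM.
  by exists 0%MM, 0%MM; rewrite add0m mdeg0.
rewrite mdegD mdeg1 !addSn ltnS add0n => /IHs[a [b [-> a_s b_t]]].
by exists (U_(i) + a)%MM, b; rewrite addmA mdegD mdeg1 ltnS.
Qed.

(** An exponent vector is an [n]-tuple over ['I_t.+1] with sum at most [t], and such tuples are
    counted by [card_partial_ord_partitions]. *)
Lemma card_bmultinom_le n t : (#|{: 'X_{1..n < t.+1}}| <= 'C(n + t, t))%N.
Proof.
have bnd (m : 'X_{1..n < t.+1}) i : (m i < t.+1)%N.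
  by apply: leq_ltn_trans (bmdeg m); rewrite mdegE (bigD1 i)//= leq_addr.
pose f (m : 'X_{1..n < t.+1}) : n.-tuple 'I_t.+1 := [tuple Ordinal (bnd m i) | i < n].
have f_inj : injective f.
  move=> m1 m2 /(congr1 (fun u => fun i => val (tnth u i))) e.
  apply/val_inj/mnmP => i; have := congr1 (@^~ i) e.
  by rewrite /f !tnth_mktuple.
rewrite -[in X in (_ <= X)%N](@bin_sub (n + t) t) ?leq_addl// addnK.
rewrite -card_partial_ord_partitions -(card_imset _ f_inj) subset_leq_card//.
apply/fintype.subsetP => _ /imsetP[m _ ->]; rewrite inE big_tuple.
rewrite (eq_bigr (fun i => m i)) => [|i _]; last by rewrite tnth_mktuple.
by rewrite -mdegE -ltnS bmdeg.
Qed.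

Lemma card_bmultinom_double n t :
  (#|{: 'X_{1..n < (2 * t).+1}}| <= 'C(n + t, t) ^ 2)%N.
Proof.
pose f (p : 'X_{1..n < t.+1} * 'X_{1..n < t.+1}) : 'X_{1..n < (2 * t).+1} :=
  (* The default [bm0] is never taken: two degrees at most [t] add up to at most [2 * t]. *)
  insubd bm0 (p.1 + p.2)%MM.
apply: (@leq_trans #|f @: finset.setT|); last first.
  apply: leq_trans (leq_imset_card _ _) _.
  by rewrite cardsT card_prod -mulnn leq_mul// card_bmultinom_le.
apply/subset_leq_card/fintype.subsetP => m _; apply/imsetP.
have [|a [b [mab a_t b_t]]] := @mnm_split n m t t.
  by rewrite addnn -mul2n -ltnS bmdeg.
rewrite -ltnS in a_t; rewrite -ltnS in b_t.
exists (BMultinom a_t, BMultinom b_t) => //; apply: val_inj.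
by rewrite /f val_insubd /= -mab bmdeg.
Qed.

(** * Truncated quadratic modules *)

Lemma deg_leM (R : realType) n (p q : {mpoly R[n]}) k l :
  deg_le p k -> deg_le q l -> deg_le (p * q) (k + l).
Proof.
rewrite /deg_le => pk ql.
have [->|p0] := eqVneq p 0; first by rewrite mul0r msize0.
have [->|q0] := eqVneq q 0; first by rewrite mulr0 msize0.
by rewrite msizeM//; move: (mmeasure _ p) (mmeasure _ q) pk ql => a b; lia.
Qed.

Lemma is_sosM_sqr (R : realType) n (p q : {mpoly R[n]}) :
  is_sos p -> is_sos (q ^+ 2 * p).
Proof.
move=> [s ->]; exists [seq q * h | h <- s].
by rewrite big_map mulr_sumr; apply: eq_bigr => h _; rewrite exprMn.
Qed.

Lemma qmodule_sqr (R : realType) n r (g : 'I_r -> {mpoly R[n]}) l (q : {mpoly R[n]}) :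
  deg_le (q ^+ 2) l -> qmodule g l (q ^+ 2).
Proof.
move=> ql; exists (q ^+ 2), (fun=> 0); split => //.
- by exists [:: q]; rewrite big_seq1.
- by move=> i; exists [::]; rewrite big_nil.
- by move=> i; rewrite mul0r /deg_le msize0.
- by rewrite big1 ?addr0// => i _; rewrite mul0r.
Qed.

Lemma deg_le_trans (R : realType) n (p : {mpoly R[n]}) k l :
  deg_le p k -> (k <= l)%N -> deg_le p l.
Proof. by rewrite /deg_le => /leq_trans pk kl; apply: pk. Qed.

(** The factor [q ^+ 2] is absorbed by the sum-of-squares multipliers, each product gaining degree
    at most [2 * k']. *)
Lemma qmoduleM_sqr (R : realType) n r (g : 'I_r -> {mpoly R[n]}) (k k' l : nat)
    (p q : {mpoly R[n]}) :
  qmodule g k p -> deg_le q k' -> (2 * k' + k <= l)%N -> qmodule g l (q ^+ 2 * p).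
Proof.
move=> [s0 [s [s0s ss s0k sk ->]]] qk kl.
have q2 : deg_le (q ^+ 2) (2 * k') by rewrite mul2n -addnn expr2 deg_leM.
exists (q ^+ 2 * s0), (fun i => q ^+ 2 * s i); split.
- exact: is_sosM_sqr.
- by move=> i; apply: is_sosM_sqr.
- by apply: deg_le_trans kl; apply: deg_leM.
- by move=> i; rewrite -mulrA; apply: deg_le_trans kl; apply: deg_leM.
- by rewrite mulrDr mulr_sumr; congr (_ + _); apply: eq_bigr => i _; rewrite mulrA.
Qed.

Lemma qmodule_ge0 (R : realType) n r (g : 'I_r -> {mpoly R[n]}) l p x :
  qmodule g l p -> semialg g x -> 0 <= peval p x.
Proof.
have sos_ge0 q : is_sos q -> 0 <= peval q x.
  move=> [s ->]; rewrite /peval raddf_sum sumr_ge0// => h _.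
  by rewrite /= rmorphXn/= sqr_ge0.
move=> [s0 [s [/sos_ge0 s00 ss _ _ ->]]] Sx.
rewrite /peval mevalD raddf_sum addr_ge0// sumr_ge0// => i _.
by rewrite /= mevalM mulr_ge0 ?Sx//; apply/sos_ge0/ss.
Qed.

(** * Linearity of functionals given on monomials *)

(** Replaces the support of [p] by an index set independent of [p], so that sums for different
    polynomials can be added termwise. *)
Lemma lapplywE (R : realType) n (L : 'X_{1..n} -> R) k (p : {mpoly R[n]}) :
  (msize p <= k)%N -> lapply L p = \sum_(m : 'X_{1..n < k}) p@_m * L m.
Proof.
move=> pk; pose I : subFinType _ := 'X_{1..n < k}.
rewrite /lapply (big_mksub I)/=; first last.
- by move=> x /msize_mdeg_lt /leq_trans; apply.
- exact: msupp_uniq.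
by rewrite big_rmcond //= => i /memN_msupp_eq0 ->; rewrite mul0r.
Qed.

Lemma lapplyX (R : realType) n (L : 'X_{1..n} -> R) m : lapply L 'X_[m] = L m.
Proof. by rewrite /lapply msuppX big_seq1 mcoeffX eqxx mul1r. Qed.

Lemma lapplyDZ (R : realType) n (L : 'X_{1..n} -> R) (c : R) (p q : {mpoly R[n]}) :
  lapply L (c *: p + q) = c * lapply L p + lapply L q.
Proof.
pose k := maxn (msize (c *: p + q)) (maxn (msize p) (msize q)).
rewrite !(@lapplywE _ _ L k) ?leq_max ?leqnn ?orbT// mulr_sumr -big_split/=.
by apply: eq_bigr => m _; rewrite mcoeffD mcoeffZ mulrDl mulrA.
Qed.

Lemma lapply0 (R : realType) n (L : 'X_{1..n} -> R) : lapply L 0 = 0.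
Proof. by rewrite /lapply msupp0 big_nil. Qed.

Lemma lapplyD (R : realType) n (L : 'X_{1..n} -> R) : {morph lapply L : p q / p + q}.
Proof. by move=> p q; rewrite -[p in LHS]scale1r lapplyDZ mul1r. Qed.

Lemma lapplyZ (R : realType) n (L : 'X_{1..n} -> R) c p :
  lapply L (c *: p) = c * lapply L p.
Proof. by rewrite -[_ *: _]addr0 lapplyDZ lapply0 addr0. Qed.

Lemma lapplyB (R : realType) n (L : 'X_{1..n} -> R) p q :
  lapply L (p - q) = lapply L p - lapply L q.
Proof. by rewrite lapplyD -scaleN1r lapplyZ mulN1r. Qed.

Lemma lapply_sum (R : realType) n (L : 'X_{1..n} -> R) (I : Type) (s : seq I)
    (F : I -> {mpoly R[n]}) :
  lapply L (\sum_(i <- s) F i) = \sum_(i <- s) lapply L (F i).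
Proof. by rewrite (big_morph _ (lapplyD L) (lapply0 L)). Qed.

(** * Bounds on the cube *)

Lemma qmodule_ball_in_cube (R : realType) n r (g : 'I_r -> {mpoly R[n]}) l :
  qmodule g l (1 - sqnorm R n) -> semialg g `<=` @cube R n.
Proof.
move=> gl x /(qmodule_ge0 gl); rewrite /peval mevalB meval1 subr_ge0 /sqnorm raddf_sum/=.
move=> xle i; rewrite -ler_norml -(@expr_le1 _ 2)// -normrX ger0_norm ?sqr_ge0//.
apply: le_trans xle; rewrite (bigD1 i)//= rmorphXn/= mevalXU lerDl.
by apply: sumr_ge0 => j _; rewrite rmorphXn/= sqr_ge0.
Qed.

Lemma norm_monom_le1 (R : realType) n (a : 'X_{1..n}) (x : n.-tuple R) :
  cube x -> `|monom a x| <= 1.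
Proof.
move=> xc; rewrite /monom normr_prod prodr_ile1// => i _.
by rewrite normr_ge0/= normrX exprn_ile1// ler_norml.
Qed.

(** * Bounds on functionals nonnegative on the quadratic module *)

Section nonneg_functional.
Context {R : realType} {n r : nat} {g : 'I_r -> {mpoly R[n]}} {L : 'X_{1..n} -> R}.
Context {l l0 t : nat}.
Hypothesis Lge0 : forall q, qmodule g l q -> 0 <= lapply L q.
Hypothesis L1 : lapply L 1 = 1.
Hypothesis archi : qmodule g l0 (1 - sqnorm R n).
Hypothesis l0tl : (2 * t + l0 <= l)%N.

Lemma functional_square_ge0 m : (mdeg m <= t)%N -> 0 <= L (m + m)%MM.
Proof.
move=> mt; rewrite -lapplyX mpolyXD -expr2; apply/Lge0/qmodule_sqr.
by rewrite /deg_le expr2 -mpolyXD msizeX ltnS mdegD; lia.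
Qed.

(** Induction on the degree. With [m = U_(i) + m'], applying [L] to ['X_[m'] ^+ 2 * (1 - sqnorm R
    n)] shows that the values of [L] at the doubles of all [U_(j) + m'] sum to at most
    [L (m' + m')]. All of them are nonnegative, so the one for [j = i] alone obeys this bound. *)
Lemma functional_square_le1 m : (mdeg m <= t)%N -> L (m + m)%MM <= 1.
Proof.
elim: {m}(mdeg m) {-2}m (erefl (mdeg m)) => [m /eqP|k IHk m mk].
  by rewrite mdeg_eq0 => /eqP-> _; rewrite addm0 -lapplyX mpolyX0 L1.
have := mk; have [->|/mnm_neq0_decomp[i [m' mE]]] := eqVneq m 0%MM.
  by rewrite mdeg0.
rewrite {1}mE mdegD mdeg1 add1n => -[m'k mt].
have m't : (mdeg m' < t)%N by rewrite m'k -mk.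
apply: le_trans (IHk _ m'k (ltnW m't)).
have : 0 <= lapply L ('X_[m'] ^+ 2 * (1 - sqnorm R n)).
  apply: Lge0; apply: (qmoduleM_sqr archi _ l0tl).
  by rewrite /deg_le msizeX ltnS ltnW.
rewrite mulrBr mulr1 lapplyB subr_ge0 expr2 -mpolyXD lapplyX; apply: le_trans.
rewrite /sqnorm mulr_sumr lapply_sum (bigD1 i)//=.
have XE j : 'X_[m' + m'] * 'X_j ^+ 2 = 'X_[(U_(j) + m') + (U_(j) + m')] :> {mpoly R[n]}.
  by rewrite !mpolyXD; ring.
rewrite XE lapplyX -mE lerDl sumr_ge0// => j _; rewrite XE lapplyX.
by rewrite functional_square_ge0// mdegD mdeg1 add1n.
Qed.

(** With [m = a + b], the squares of ['X_[a] + 'X_[b]] and ['X_[a] - 'X_[b]] bound [2 * |L m|] by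
    [L (a + a) + L (b + b)], which is at most 2. Both signs are treated at once through [e] with
    [e ^+ 2 = 1]. *)
Lemma functional_norm_le1 m : (mdeg m <= 2 * t)%N -> `|L m| <= 1.
Proof.
rewrite mul2n -addnn => /mnm_split[a [b [-> a_t b_t]]].
have sq (e : R) : e ^+ 2 = 1 ->
    0 <= L (a + a)%MM + L (b + b)%MM + 2 * e * L (a + b)%MM.
  move=> e2; have -> : L (a + a)%MM + L (b + b)%MM + 2 * e * L (a + b)%MM
      = lapply L (('X_[a] + e *: 'X_[b]) ^+ 2).
    have -> : ('X_[a] + e *: 'X_[b]) ^+ 2
        = 'X_[a + a] + 'X_[b + b] + (2 * e) *: 'X_[a + b] :> {mpoly R[n]}.
      rewrite !mpolyXD sqrrD exprZn e2 scale1r !expr2 -scalerAr mulr2n -scalerDl.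
      by rewrite mulrDl mul1r; ring.
    by rewrite !lapplyD lapplyZ !lapplyX.
  apply/Lge0/qmodule_sqr; apply: (@deg_le_trans _ _ _ (t + t)); last by lia.
  have : deg_le ('X_[a] + e *: 'X_[b] : {mpoly R[n]}) t.
    apply: leq_trans (msizeD_le _ _) _; rewrite geq_max msizeX ltnS a_t/=.
    by apply: leq_trans (msizeZ_le _ _) _; rewrite msizeX ltnS.
  by rewrite expr2 => h; apply: deg_leM.
have sq1 := sq 1 (expr1n _ _); have sqN1 := sq (-1) (sqrr_sign _ 1).
have La := functional_square_le1 a_t; have Lb := functional_square_le1 b_t.
by rewrite ler_norml; apply/andP; split; lra.
Qed.

End nonneg_functional.

(** * Measurability and integration *)

Lemma measurable_monom (R : realType) n (a : 'X_{1..n}) :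
  measurable_fun setT (@monom R n a).
Proof.
by apply: measurable_prod => i _; apply: measurable_funX; apply: measurable_tnth.
Qed.

Lemma pevalE (R : realType) n (p : {mpoly R[n]}) x :
  peval p x = \sum_(m <- msupp p) p@_m * monom m x.
Proof. by rewrite /peval mevalE. Qed.

Lemma measurable_peval (R : realType) n (p : {mpoly R[n]}) :
  measurable_fun setT (peval p).
Proof.
rewrite (_ : peval p = fun x => \sum_(m <- msupp p) p@_m * monom m x); last first.
  by apply/funext => x; rewrite pevalE.
apply: measurable_sum => m; apply: measurable_funM; first exact: measurable_cst.
exact: measurable_monom.
Qed.

Lemma measurable_semialg (R : realType) n r (g : 'I_r -> {mpoly R[n]}) :
  measurable (semialg g).
Proof.
rewrite (_ : semialg g = \bigcap_(i in setT) (peval (g i) @^-1` `[0, +oo[)).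
  apply: fin_bigcap_measurable => // i _; rewrite -[X in measurable X]setTI.
  by apply: measurable_peval => //; apply: measurable_itv.
apply/seteqP; split => x /=.
  by move=> Sx i _ /=; rewrite in_itv/= andbT.
by move=> Sx i; have := Sx i I; rewrite /= in_itv/= andbT.
Qed.

(** Monomials are bounded on [S] but not on the whole space; the null complement of [S] is discarded
    before the boundedness criterion is applied. *)
Lemma integrable_bounded_conull {d} {T : measurableType d} {R : realType}
    (mu : {measure set T -> \bar R}) (S : set T) (f : T -> R) (M : R) :
  (mu setT < +oo)%E -> measurable S -> mu (~` S) = 0%E ->
  measurable_fun setT f -> (forall x, S x -> `|f x| <= M) ->
  mu.-integrable setT (EFin \o f).
Proof.
move=> muT mS muS mf fM.
apply/(@negligible_integrable _ _ _ mu setT (~` S)) => //.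
- exact: measurableC.
- exact/measurable_EFinP.
rewrite setTD setCK; apply: measurable_bounded_integrable => //.
- by apply: le_lt_trans muT; apply: le_measure; rewrite ?inE.
- exact: measurable_funTS.
- exists M; split; first exact: num_real.
  by move=> x Mx y /fM /le_trans; apply; exact: ltW.
Qed.

(** Reduces to the positive and negative parts of [f]; integrability makes the latter's integral
    finite, so that [k] distributes over the difference. *)
Lemma integral_mscale {d} {T : measurableType d} {R : realType}
    (mu : {measure set T -> \bar R}) (k : {nonneg R}) (f : T -> \bar R) :
  mu.-integrable setT f ->
  (\int[mscale k mu]_x f x = k%:num%:E * \int[mu]_x f x)%E.
Proof.
move=> fi; have mf := measurable_int _ fi.
rewrite (integralE mu) (integralE (mscale k mu)) !ge0_integral_mscale//; first last.
- exact: measurable_funepos.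
- exact: measurable_funeneg.
by rewrite [RHS]muleBr// fin_num_adde_defl// fin_numN integrable_neg_fin_num.
Qed.

Lemma integrable_mscale {d} {T : measurableType d} {R : realType}
    (mu : {measure set T -> \bar R}) (k : {nonneg R}) (f : T -> \bar R) :
  mu.-integrable setT f -> (mscale k mu).-integrable setT f.
Proof.
move=> /integrableP[mf fi]; apply/integrableP; split => //.
rewrite ge0_integral_mscale//; last exact: measurableT_comp.
by rewrite lte_mul_pinfty.
Qed.

(** * Convex combinations of two probability measures *)

Section mixture.
Context {d} {T : measurableType d} {R : realType}.
Variables (s s' : {nonneg R}) (P Q : probability T R).
Hypothesis ss' : s%:num + s'%:num = 1.

Definition mixture := measure_add (mscale s P) (mscale s' Q).

HB.instance Definition _ := Measure.on mixture.

Let mixture_setT : mixture setT = 1%E.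
Proof.
transitivity (s%:num%:E * P setT + s'%:num%:E * Q setT)%E.
  by rewrite /mixture measure_addE.
rewrite !probability_setT !mule1 -EFinD.
by rewrite ss'.
Qed.

(** Packed explicitly rather than declared as an instance on [mixture], which does not carry the
    hypothesis [ss'] that gives total mass 1. *)
Definition mixture_probability : probability T R :=
  HB.pack mixture (Measure_isProbability.Build _ _ _ mixture mixture_setT).
End mixture.

Lemma integral_mixture {d} {T : measurableType d} {R : realType} (s s' : {nonneg R})
    (P Q : probability T R) (f : T -> R) :
  P.-integrable setT (EFin \o f) -> Q.-integrable setT (EFin \o f) ->
  \int[mixture s s' P Q]_x f x = s%:num * \int[P]_x f x + s'%:num * \int[Q]_x f x.
Proof.
move=> fP fQ; rewrite /Rintegral /mixture integral_measure_add//; last 2 first.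
- exact: integrable_mscale.
- exact: integrable_mscale.
rewrite !integral_mscale// -(fineK (integrable_fin_num measurableT fP)).
by rewrite -(fineK (integrable_fin_num measurableT fQ)).
Qed.

(** * Moment vectors of probability measures on [S] *)

Section moments.
Context {R : realType} {n r : nat} {g : 'I_r -> {mpoly R[n]}} {l0 : nat}.
Hypothesis archi : qmodule g l0 (1 - sqnorm R n).

Lemma semialg_conull (P : probability (n.-tuple R) R) (A : set (n.-tuple R)) :
  measurable A -> A `<=` semialg g -> P A = 1%E -> P (~` semialg g) = 0%E.
Proof.
move=> mA AS PA; have mS := measurable_semialg g.
have : P (~` A) = 0%E by rewrite probability_setC// PA subee.
apply: subset_measure0; [exact: measurableC|exact: measurableC|].
exact: subsetC.
Qed.

Lemma integrable_monom (P : probability (n.-tuple R) R) (a : 'X_{1..n}) :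
  P (~` semialg g) = 0%E -> P.-integrable setT (EFin \o monom a).
Proof.
move=> PS; apply: (@integrable_bounded_conull _ _ _ P (semialg g) _ 1) => //.
- exact: le_lt_trans (probability_le1 P measurableT) (ltry _).
- exact: measurable_semialg.
- exact: measurable_monom.
- by move=> x /(qmodule_ball_in_cube archi); exact: norm_monom_le1.
Qed.

Lemma integrable_term (P : probability (n.-tuple R) R) (c : R) (a : 'X_{1..n}) :
  P (~` semialg g) = 0%E -> P.-integrable setT (fun x => (c * monom a x)%:E).
Proof.
move=> PS; rewrite (_ : (fun _ => _) = fun x => c%:E * (EFin \o monom a) x)%E.
  by apply: integrableZl => //; exact: integrable_monom.
by apply/funext => x; rewrite /= EFinM.
Qed.

Lemma peval_EFinE (p : {mpoly R[n]}) x :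
  (peval p x)%:E = (\sum_(m <- msupp p) (p@_m * monom m x)%:E)%E.
Proof. by rewrite pevalE sumEFin. Qed.

Lemma integrable_peval (P : probability (n.-tuple R) R) (p : {mpoly R[n]}) :
  P (~` semialg g) = 0%E -> P.-integrable setT (EFin \o peval p).
Proof.
move=> PS; have -> : EFin \o peval p
    = fun x => (\sum_(m <- msupp p) (p@_m * monom m x)%:E)%E.
  by apply/funext => x; rewrite -peval_EFinE.
by apply: integrable_sum => // m _; exact: integrable_term.
Qed.

Lemma lapply_moment (P : probability (n.-tuple R) R) (p : {mpoly R[n]}) :
  P (~` semialg g) = 0%E ->
  lapply (fun m => \int[P]_x monom m x) p = \int[P]_x peval p x.
Proof.
move=> PS; rewrite /lapply [RHS]/Rintegral.
under eq_integral do rewrite peval_EFinE.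
rewrite integral_sum//=; last by move=> m; exact: integrable_term.
rewrite -sum_fine; last first.
  by move=> m _; apply: integrable_fin_num => //; exact: integrable_term.
apply: eq_bigr => m _; rewrite -RintegralZl//.
exact: integrable_monom.
Qed.

Lemma moment_set_sub_functional_set (l t : nat) :
  moment_set g t `<=` functional_set g l t.
Proof.
move=> v [P [[A [mA AS PA]] ->]].
have PS := semialg_conull mA AS PA; have mS := measurable_semialg g.
exists (fun m => \int[P]_x monom m x); split=> // [q gq|].
- rewrite lapply_moment// /Rintegral.
  (* Off [S] the polynomial [q] may be negative; this null set is removed before comparing the
     integral with 0. *)
  rewrite (@negligible_integral _ _ _ P setT (~` semialg g))//.
  + by rewrite setTD setCK fine_ge0// integral_ge0// => x Sx; rewrite lee_fin (qmodule_ge0 gq).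
  + exact: measurableC.
  + exact: integrable_peval.
- rewrite lapply_moment// /Rintegral; under eq_integral do rewrite /peval meval1.
  by rewrite integral_cst//= probability_setT mul1e.
Qed.

(** The mixture with weights [1 - s] and [s] has these moments. The two measures may come with
    different sets of full measure, so [semialg g] serves for both. *)
Lemma moment_set_convex (t : nat) (v w : vec R n (2 * t)) (s : R) :
  0 <= s <= 1 -> moment_set g t v -> moment_set g t w ->
  moment_set g t (fun m => (1 - s) * v m + s * w m).
Proof.
move=> /andP[s0 s1] [P [[A [mA AS PA]] ->]] [Q [[B [mB BS QB]] ->]].
have PS := semialg_conull mA AS PA; have QS := semialg_conull mB BS QB.
have s1' : 0 <= 1 - s by rewrite subr_ge0.
have e : (NngNum s1')%:num + (NngNum s0)%:num = 1 by rewrite /= subrK.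
exists (mixture_probability P Q e); split.
  exists (semialg g); split => //; first exact: measurable_semialg.
  have S1 (P' : probability (n.-tuple R) R) :
      P' (~` semialg g) = 0%E -> P' (semialg g) = 1%E.
    move=> P'S; have mS := measurable_semialg g.
    by rewrite -[semialg g]setCK probability_setC ?P'S ?sube0//; exact: measurableC.
  transitivity ((1 - s)%:E * P (semialg g) + s%:E * Q (semialg g))%E.
    by rewrite -[LHS]/(mixture (NngNum s1') (NngNum s0) P Q (semialg g))
      /mixture measure_addE.
  by rewrite !S1// !mule1 -EFinD subrK.
apply/funext => m.
by rewrite -[RHS]/(\int[mixture (NngNum s1') (NngNum s0) P Q]_x monom m x)
  integral_mixture//; apply: integrable_monom.
Qed.

(** Point masses make the moment set nonempty and turn a linear inequality on it into a pointwise
    inequality on [S]. *)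
Lemma moment_set_dirac (t : nat) (x : n.-tuple R) : semialg g x ->
  moment_set g t (fun m => monom m x).
Proof.
move=> Sx; exists \d_x; split.
  exists (semialg g); split=> //; first exact: measurable_semialg.
  by rewrite /= diracE mem_set.
apply/funext => m; have mm := measurable_monom (R := R) m.
by rewrite integral_dirac ?diracT ?mul1e//; exact/measurable_EFinP.
Qed.

End moments.

(** * Separation of a point from a convex set *)

(* [K] need not be closed: an approximate minimiser [w0] of the distance to [v] stands in
   for the projection, at the price of replacing [d] by a smaller [e]. *)
Lemma separation_convex_bounded (R : realType) (I : finType) (K : set (I -> R))
    (v : I -> R) (M e d : R) :
  K !=set0 -> (forall w i, K w -> `|w i| <= M) ->
  (forall w y s, 0 <= s <= 1 -> K w -> K y -> K (fun i => (1 - s) * w i + s * y i)) ->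
  0 < e -> e < d -> (forall w, K w -> d ^+ 2 <= \sum_i (v i - w i) ^+ 2) ->
  exists a : I -> R, \sum_i a i ^+ 2 = 1 /\
    forall y, K y -> e <= \sum_i a i * (y i - v i).
Proof.
move=> [k0 Kk0] KM Kconv e0 ed dK; have d0 := lt_trans e0 ed.
pose N w := \sum_i (v i - w i) ^+ 2.
(* [B] bounds the squared distance between points of [K], [kap] is the allowed slack, and the step
   length [s] in []0, 1]] is chosen so that [s * B <= kap]. *)
pose B := \sum_(i : I) (2 * M) ^+ 2.
have B0 : 0 <= B by apply: sumr_ge0 => i _; exact: sqr_ge0.
pose kap := d * (d - e); have kap0 : 0 < kap by rewrite mulr_gt0// subr_gt0.
pose s := kap / (B + kap); have Bk : 0 < B + kap by rewrite ltr_wpDl.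
have s0 : 0 < s by rewrite divr_gt0.
have s1 : s <= 1 by rewrite ler_pdivrMr// mul1r lerDr.
have sB : s * B <= kap.
  rewrite /s mulrAC -mulrA ler_piMr//; first exact: ltW.
  by rewrite ler_pdivrMr// mul1r lerDl ltW.
have NK : has_inf [set N w | w in K].
  by split; [exists (N k0), k0|exists (d ^+ 2) => _ [w Kw <-]; exact: dK].
have [|_ [w0 Kw0 <-] w0D] := inf_adherent (eps := s * kap) _ NK.
  by rewrite mulr_gt0.
have dN : d ^+ 2 <= N w0 by exact: dK.
pose rho := Num.sqrt (N w0).
have rho2 : rho ^+ 2 = N w0 by rewrite sqr_sqrtr// (le_trans _ dN)// sqr_ge0.
have drho : d <= rho by have := ler_wsqrtr dN; rewrite sqrtr_sqr gtr0_norm.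
have rho0 : 0 < rho by exact: lt_le_trans drho.
exists (fun i => (w0 i - v i) / rho); split.
  under eq_bigr do rewrite exprMn -[(w0 _ - _) ^+ 2]sqrrN opprB.
  by rewrite -mulr_suml -/(N w0) -rho2 -exprMn divff ?gt_eqF// expr1n.
move=> y Ky.
have -> : \sum_i (w0 i - v i) / rho * (y i - v i)
    = (\sum_i (w0 i - v i) * (y i - v i)) / rho.
  by rewrite mulr_suml; apply: eq_bigr => i _; rewrite mulrAC.
rewrite ler_pdivlMr//.
pose p := \sum_i (w0 i - v i) * (y i - w0 i).
pose Q := \sum_i (y i - w0 i) ^+ 2.
have -> : \sum_i (w0 i - v i) * (y i - v i) = N w0 + p.
  by rewrite -big_split/=; apply: eq_bigr => i _; ring.
have QB : Q <= B.
  apply: ler_sum => i _; rewrite -[leLHS]real_normK ?num_real//.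
  apply: lerXn2r; rewrite ?nnegrE ?normr_ge0//.
    by rewrite mulr_ge0//; exact: le_trans (KM _ i Kw0).
  apply: le_trans (ler_normB _ _) _.
  by rewrite mulr_natl mulr2n lerD// KM.
(* Moving from [w0] towards [y] by the fraction [s] stays in [K] and changes [N] by
   [s * (2 * p + s * Q)]. As [N w0] exceeds the infimum by less than [s * kap], this forces
   [2 * p + s * Q > - kap], whence [p > - kap]. *)
have : inf [set N w | w in K] <= N w0 + s * (2 * p + s * Q).
  apply: ge_inf; first exact: NK.2.
  exists (fun i => (1 - s) * w0 i + s * y i).
    by apply: Kconv => //; rewrite s1 ltW.
  rewrite /p /Q /N !mulr_sumr -!big_split mulr_sumr -big_split/=.
  by apply: eq_bigr => i _; ring.
move=> DN; have : - kap < 2 * p + s * Q.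
  by rewrite -(ltr_pM2l s0); lra.
have sQ : s * Q <= kap by apply: le_trans sB; rewrite ler_pM2l.
(* From [d <= rho]. Then [N w0 + p > rho ^+ 2 - kap >= rho * e], as required. *)
have : kap <= rho * (rho - e).
  by apply: ler_pM => //; rewrite ?lerD2r// ?subr_ge0 ltW.
by rewrite -rho2 mulrBr -expr2 => ? ?; lra.
Qed.

(** This is Cauchy-Schwarz, [y] having Euclidean norm at most the square root of [#|I|], hence at
    most [C]; a coordinatewise estimate avoids the roots. *)
Lemma unit_vector_dot_le (R : realType) (I : finType) (a y : I -> R) (C : nat) :
  \sum_i a i ^+ 2 = 1 -> (forall i, `|y i| <= 1) -> (#|I| <= C ^ 2)%N ->
  `|\sum_i a i * y i| <= C%:R.
Proof.
move=> a1 y1 IC; apply: le_trans (ler_norm_sum _ _ _) _.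
have [C0|C0] := eqVneq C 0%N.
  have : #|I| = 0%N by apply/eqP; rewrite -leqn0 (leq_trans IC)// C0.
  by move=> /card0_eq I0; rewrite big_pred0.
have C0' : 0 < C%:R :> R by rewrite ltr0n lt0n.
(* AM-GM: [2 |a_i| <= C a_i^2 + 1 / C] *)
have aC i : `|a i * y i| <= (C%:R * a i ^+ 2 + C%:R^-1) / 2.
  rewrite normrM; apply: (@le_trans _ _ `|a i|); first by rewrite ler_piMr.
  rewrite ler_pdivlMr// -(ler_pM2l C0') [leRHS]mulrDr divff ?gt_eqF//.
  have := sqr_ge0 (C%:R * `|a i| - 1).
  by rewrite -[a i ^+ 2]real_normK ?num_real// => ?; lra.
apply: le_trans (ler_sum _ (fun i _ => aC i)) _.
rewrite -mulr_suml big_split/= -mulr_sumr a1 mulr1 sumr_const.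
have : C%:R^-1 *+ #|I| <= C%:R :> R.
  by rewrite -[leLHS]mulr_natl ler_pdivrMr// -natrM mulnn ler_nat.
by move=> ?; lra.
Qed.

(** * Numerical estimate for the Positivstellensatz *)

(** Here [q] stands for [n%:R * Lo]. The factor 2 in [2 * t] contributes the exponent [7 / 2 * q]
    and the one in [2 * C] contributes [5 / 2 * q]; the resulting power of 2 is absorbed by the
    power of 6. The exponent of [t] is raised to [6 * q], which [1 <= t] permits. *)
Lemma putinar_degree_bound (R : realType) (gam eps ef C q : R) (t D : nat) :
  0 <= gam -> 0 < eps -> 0 < C -> 0 <= q -> (1 <= t)%N -> (D <= 2 * t)%N ->
  eps / (2 * C) <= ef ->
  gam * D%:R `^ (7 / 2 * q) * ef `^ (- (5 / 2 * q)) <=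
  gam * 6 `^ (5 / 2 * q) * t%:R `^ (6 * q) * C `^ (5 / 2 * q)
    * eps `^ (- (5 / 2 * q)).
Proof.
move=> gam0 eps0 C0 q0 t1 Dt efC.
have t1' : 1 <= t%:R :> R by rewrite ler1n.
have D_le : D%:R `^ (7 / 2 * q) <= 2 `^ (7 / 2 * q) * t%:R `^ (6 * q).
  apply: (@le_trans _ _ ((2 * t)%:R `^ (7 / 2 * q))).
    by apply: ge0_ler_powR; rewrite ?nnegrE ?ler0n ?ler_nat//; lra.
  rewrite natrM powRM ?ler0n// ler_wpM2l ?powR_ge0//.
  by apply: ler_powR => //; lra.
have ef_le : ef `^ (- (5 / 2 * q))
    <= 2 `^ (5 / 2 * q) * C `^ (5 / 2 * q) * eps `^ (- (5 / 2 * q)).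
  have eC0 : 0 < eps / (2 * C) by rewrite divr_gt0// mulr_gt0.
  have epsE : eps `^ (5 / 2 * q)
      = (eps / (2 * C)) `^ (5 / 2 * q) * (2 `^ (5 / 2 * q) * C `^ (5 / 2 * q)).
    have C2 : 0 < 2 * C by rewrite mulr_gt0.
    by rewrite -(powRM _ (ler0n _ 2) (ltW C0)) -(powRM _ (ltW eC0) (ltW C2)) divfK ?gt_eqF.
  (* The exponent being negative, inverses are compared, which reverses the bound
     [eps / (2 * C) <= ef]. *)
  rewrite !powRN epsE invfM mulrCA divff ?mulf_neq0 ?gt_eqF ?powR_gt0// mulr1.
  rewrite lef_pV2 ?posrE ?powR_gt0//; last exact: lt_le_trans efC.
  by apply: ge0_ler_powR; rewrite ?nnegrE ?(ltW eC0)//; lra.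
(* [2 ^ 12 <= 6 ^ 5] *)
have two_six : 2 `^ (7 / 2 * q) * 2 `^ (5 / 2 * q) <= 6 `^ (5 / 2 * q) :> R.
  rewrite -powRD; last by rewrite pnatr_eq0 implybT.
  have -> : 7 / 2 * q + 5 / 2 * q = 12%:R * (q / 2) by field.
  have -> : 5 / 2 * q = 5%:R * (q / 2) by field.
  rewrite (powRrM 2 12%:R) (powRrM 6 5%:R) (powR_mulrn 12 (ler0n _ 2)).
  rewrite (powR_mulrn 5 (ler0n _ 6)); apply: ge0_ler_powR.
  - by rewrite divr_ge0.
  - by rewrite nnegrE exprn_ge0.
  - by rewrite nnegrE exprn_ge0.
  - by rewrite -!natrX ler_nat.
have := ler_pM (powR_ge0 _ _) (powR_ge0 _ _) D_le ef_le.
move=> /(ler_wpM2l gam0) h; rewrite -[leLHS]mulrA; apply: le_trans h _.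
have := ler_wpM2l (mulr_ge0 gam0 (mulr_ge0 (powR_ge0 t%:R (6 * q))
  (mulr_ge0 (powR_ge0 C (5 / 2 * q)) (powR_ge0 eps (- (5 / 2 * q)))))) two_six.
by congr (_ <= _); ring.
Qed.

(** * The separating polynomial *)

Section separating_polynomial.
Context {R : realType} {n t : nat}.
Variables (a : 'X_{1..n < (2 * t).+1} -> R) (c : R).
Hypothesis a1 : \sum_m a m ^+ 2 = 1.

(** Encodes the affine function [w |-> \sum_m a m * w m - c] on truncated vectors: evaluation at [x]
    gives its value at the vector of the point mass at [x], and [L] its value at the vector of
    [L]. *)
Definition affine_poly : {mpoly R[n]} := \sum_m a m *: 'X_[m] - c%:MP.

Lemma peval_affine_poly x : peval affine_poly x = \sum_m a m * monom m x - c.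
Proof.
rewrite /peval /affine_poly mevalB mevalC raddf_sum; congr (_ - _).
by apply: eq_bigr => m _; rewrite /= mevalZ mevalX.
Qed.

Lemma lapply_affine_poly (L : 'X_{1..n} -> R) :
  lapply L 1 = 1 -> lapply L affine_poly = \sum_m a m * L m - c.
Proof.
move=> L1; rewrite /affine_poly lapplyB lapply_sum -[c%:MP]mulr1 mul_mpolyC.
rewrite lapplyZ L1 mulr1; congr (_ - _).
by apply: eq_bigr => m _; rewrite lapplyZ lapplyX.
Qed.

Lemma pdeg_affine_poly : (pdeg affine_poly <= 2 * t)%N.
Proof.
rewrite /pdeg -subn1 leq_subLR add1n; apply: leq_trans (msizeD_le _ _) _.
rewrite geq_max msizeN msizeC (leq_trans (leq_b1 _))// andbT.
apply: leq_trans (msize_sum _ _ _) _; apply/bigmax_leqP => m _.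
by apply: leq_trans (msizeZ_le _ _) _; rewrite msizeX bmdeg.
Qed.

(** One binomial coefficient comes from Cauchy-Schwarz, the other from the constant [c]. *)
Lemma norm_affine_poly_le x : cube x -> `|c| <= 'C(n + t, t)%:R ->
  `|peval affine_poly x| <= 2 * 'C(n + t, t)%:R.
Proof.
move=> xc cC; rewrite peval_affine_poly; apply: le_trans (ler_normB _ _) _.
rewrite mulr_natl mulr2n lerD//.
apply: unit_vector_dot_le => //; first by move=> m; exact: norm_monom_le1.
exact: card_bmultinom_double.
Qed.

End separating_polynomial.

Lemma eps_f_ge (R : realType) n r (g : 'I_r -> {mpoly R[n]}) (f : {mpoly R[n]})
    (e B : R) :
  semialg g !=set0 -> semialg g `<=` @cube R n -> 0 < e ->
  (forall x, semialg g x -> e <= peval f x) ->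
  (forall x, cube x -> `|peval f x| <= B) ->
  0 < pmin g f /\ e / B <= eps_f g f.
Proof.
move=> [x0 Sx0] Sc e0 ef fB.
have pe : e <= pmin g f.
  by apply: lb_le_inf; [exists (peval f x0), x0|move=> _ [x Sx <-]; exact: ef].
have bnd : ubound [set `|peval f x| | x in @cube R n] B by move=> _ [x xc <-]; exact: fB.
have sB : supnorm f <= B.
  by apply: ge_sup => //; exists `|peval f x0|, x0 => //; exact: Sc.
(* Positivity of the norm, read off at a point of [S], rules out the default value of division by
   zero in [eps_f]. *)
have s0 : 0 < supnorm f.
  apply: (@lt_le_trans _ _ `|peval f x0|).
    by rewrite normr_gt0 gt_eqF// (lt_le_trans e0)// ef.
  by apply: ub_le_sup; [exists B|exists x0 => //; exact: Sc].
split; first exact: lt_le_trans pe.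
rewrite /eps_f ler_pdivlMr// mulrAC ler_pdivrMr; last exact: lt_le_trans sB.
by apply: ler_pM => //; exact: ltW.
Qed.

(** * Distance from a functional to the moment set *)

Lemma setdist_functional_le (R : realType) n r (g : 'I_r -> {mpoly R[n]})
    (l0 : nat) (Lo gam eps : R) (t l : nat) (v : vec R n (2 * t)) :
  qmodule g l0 (1 - sqnorm R n) -> semialg g !=set0 -> 0 <= Lo -> 0 <= gam ->
  (forall f : {mpoly R[n]}, 0 < pmin g f ->
     forall l' : nat,
       gam * (pdeg f)%:R `^ (7 / 2 * n%:R * Lo)
           * eps_f g f `^ (- (5 / 2 * n%:R * Lo)) <= l'%:R ->
       qmodule g l' f) ->
  0 < eps -> (1 <= t)%N ->
  gam * 6 `^ (5 / 2 * n%:R * Lo) * t%:R `^ (6 * n%:R * Lo)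
      * ('C(n + t, t))%:R `^ (5 / 2 * n%:R * Lo)
      * eps `^ (- (5 / 2 * n%:R * Lo)) <= l%:R ->
  (2 * t + l0 <= l)%N ->
  functional_set g l t v -> (setdist v (moment_set g t) <= eps%:E)%E.
Proof.
move=> archi S0 Lo0 gam0 putinar eps0 t1 ell l0l [L [Lge0 L1 ->]].
rewrite leNgt; apply/negP => far.
pose C : R := 'C(n + t, t)%:R.
have C0 : 0 < C by rewrite ltr0n bin_gt0 leq_addl.
have [x0 Sx0] := S0; have Sc := qmodule_ball_in_cube archi.
have Lm m : (mdeg m <= 2 * t)%N -> `|L m| <= 1.
  exact: (functional_norm_le1 Lge0 L1 archi l0l).
have [d ed dfar] : exists2 d, eps < d & forall w, moment_set g t w ->
    d <= vdist (fun m : 'X_{1..n < (2 * t).+1} => L m) w.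
  pose D := setdist (fun m : 'X_{1..n < (2 * t).+1} => L m) (moment_set g t).
  have Dle w : moment_set g t w -> (D <= (vdist (fun m : 'X_{1..n < (2 * t).+1} => L m) w)%:E)%E.
    by move=> Mw; apply: ereal_inf_lbound; exists w.
  (* The distance is finite because a point of [S] yields a moment vector. *)
  have Dfin : D \is a fin_num.
    rewrite fin_numE gt_eqF ?(lt_trans _ far) ?ltNyr//=.
    by rewrite lt_eqF// (le_lt_trans (Dle _ (moment_set_dirac _ Sx0))) ?ltry.
  exists (fine D); first by rewrite -lte_fin fineK.
  by move=> w Mw; rewrite -lee_fin fineK// Dle.
(* The midpoint leaves room on both sides: [e < d] for the approximate separation, [eps < e] for
   making [L f] negative. *)
pose e := (eps + d) / 2.
have [ee de] : eps < e /\ e < d by rewrite /e; split; lra.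
have [a [a1 aS]] : exists a : 'X_{1..n < (2 * t).+1} -> R, \sum_m a m ^+ 2 = 1 /\
    forall y, moment_set g t y -> e <= \sum_m a m * (y m - L m).
  apply: (@separation_convex_bounded _ _ _ _ 1 _ d) => //.
  - by exists (fun m => monom (bmnm m) x0); exact: moment_set_dirac.
  (* Moment vectors are themselves truncated functionals, so they inherit the coordinate bound 1. *)
  - move=> w m /(moment_set_sub_functional_set archi l)[L' [L'ge0 L'1 ->]].
    by apply: (functional_norm_le1 L'ge0 L'1 archi l0l); rewrite -ltnS bmdeg.
  - by move=> w y s s01 Mw My; exact: (moment_set_convex archi).
  - exact: lt_trans ee.
  - move=> w /dfar; rewrite /vdist => dw.
    have d0 : 0 <= d by rewrite ltW// (lt_trans eps0).
    rewrite -[leRHS]sqr_sqrtr; last by apply: sumr_ge0 => m _; exact: sqr_ge0.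
    by apply: lerXn2r; rewrite ?nnegrE ?sqrtr_ge0.
have cardC := card_bmultinom_double n t.
pose La := \sum_(m : 'X_{1..n < (2 * t).+1}) a m * L m.
have LaC : `|La| <= C.
  by apply: unit_vector_dot_le => // m; apply: Lm; rewrite -ltnS bmdeg.
(* With this constant, [f] is at least [eps] on [S], while [L f = eps - e < 0]. *)
pose c := La + (e - eps).
have aSx x : semialg g x -> La + e <= \sum_m a m * monom m x.
  move=> /(moment_set_dirac t)/aS; under eq_bigr do rewrite mulrBr.
  by rewrite big_split/= sumrN -/La lerBrDl addrC.
(* [c] lies between [La] and the value of [\sum_m a m * monom m x0], both in [[-C, C]]. *)
have cC : `|c| <= C.
  have : `|\sum_m a m * monom (bmnm m) x0| <= C.
    by apply: unit_vector_dot_le => // m; apply/norm_monom_le1/Sc.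
  move: LaC (aSx _ Sx0); rewrite !ler_norml /c => /andP[? ?] ? /andP[? ?].
  by apply/andP; split; lra.
pose f := affine_poly a c.
have fS x : semialg g x -> eps <= peval f x.
  by move=> /aSx; rewrite peval_affine_poly /c => ?; lra.
have [pf ef] := eps_f_ge S0 Sc eps0 fS (fun x xc => norm_affine_poly_le a1 xc cC).
have /Lge0 : qmodule g l f.
  have nLo0 : 0 <= n%:R * Lo by rewrite mulr_ge0.
  have := putinar_degree_bound gam0 eps0 C0 nLo0 t1 (pdeg_affine_poly a c) ef.
  rewrite !(mulrA _ n%:R Lo) => bound.
  by apply: (putinar _ pf); exact: le_trans bound ell.
by rewrite lapply_affine_poly// -/La /c => ?; lra.
Qed.

Theorem mainTheorem2 (R : realType) (n r : nat) (g : 'I_r -> {mpoly R[n]})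
  (l0 : nat) (c Lo gam eps : R) (t l : nat) :
  (2 <= n)%N ->
  (forall i, supnorm (g i) <= 1 / 2) ->
  qmodule g l0 (1 - sqnorm R n) ->
  semialg g !=set0 ->
  1 <= c -> 1 <= Lo ->
  (forall x, cube x -> Dist g x `^ Lo <= c * Gviol g x) ->
  1 <= gam ->
  (forall f : {mpoly R[n]}, 0 < pmin g f ->
     forall l' : nat,
       gam * (pdeg f)%:R `^ (7 / 2 * n%:R * Lo)
           * eps_f g f `^ (- (5 / 2 * n%:R * Lo)) <= l'%:R ->
       qmodule g l' f) ->
  0 < eps <= 1 / 2 ->
  (1 <= t)%N ->
  gam * 6 `^ (5 / 2 * n%:R * Lo) * t%:R `^ (6 * n%:R * Lo)
      * ('C(n + t, t))%:R `^ (5 / 2 * n%:R * Lo)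
      * eps `^ (- (5 / 2 * n%:R * Lo)) <= l%:R ->
  (2 * t + l0 <= l)%N ->
  (hausdorff (moment_set g t) (functional_set g l t) <= eps%:E)%E.
Proof.
move=> _ _ archi S0 _ Lo1 _ gam1 putinar /andP[eps0 _] t1 ell l0l.
rewrite /hausdorff ge_max; apply/andP; split; apply: ge_ereal_sup => _ [v Mv <-].
  apply: ge_ereal_inf; exists 0%E; last by rewrite lee_fin ltW.
  exists v; first exact: (moment_set_sub_functional_set archi).
  rewrite /vdist big1 ?sqrtr0// => m _.
  by rewrite subrr expr0n.
apply: (setdist_functional_le archi S0 _ _ putinar eps0 t1 ell l0l Mv).
  exact: le_trans Lo1.
exact: le_trans gam1.
Qed.
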